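(* Let $\lambda$ be a nonzero real number and let $\phi_{n,\lambda}(x)$ ($n\ge 0$) be the degenerate Bell polynomials. Then for every integer $n\ge 0$, $$\phi_{n+1,\lambda}(x)=x\sum_{k=0}^{n}\binom{n}{k}(1-\lambda)_{n-k,\lambda}\,\phi_{k,\lambda}(x),$$ and $$x\,\phi_{n,\lambda}(x)=\sum_{k=0}^{n}\binom{n}{k}(\lambda-1)_{n-k,\lambda}\,\phi_{k+1,\lambda}(x).$$
   Context: For a nonzero real number $\lambda$: generalized falling factorials $(x)_{0,\lambda}=1$, $(x)_{n,\lambda}=x(x-\lambda)\cdots(x-(n-1)\lambda)$ for $n\ge 1$. With $(x)_0=1$ and $(x)_n=x(x-1)\cdots(x-n+1)$ for $n\ge 1$, the degenerate Stirling numbers of the second kind ${n \brace k}_{\lambda}$ ($0\le k\le n$) are defined by the polynomial identity $(x)_{n,\lambda}=\sum_{k=0}^{n}{n \brace k}_{\lambda}(x)_{k}$, $n\ge 0$. The degenerate Bell polynomials are $\phi_{n,\lambda}(x)=\sum_{k=0}^{n}{n \brace k}_{\lambda}x^{k}$. *)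

(* Defs.v *)
From HB Require Import structures.
From mathcomp Require Import all_boot all_order all_algebra.
From mathcomp Require Import reals.
Set Implicit Arguments.
Unset Strict Implicit.
Unset Printing Implicit Defensive.
Import GRing.Theory.
Local Open Scope ring_scope.

(* x (x - lam) ... (x - (n - 1) lam).  The ring A is either the reals, or the
   real polynomials (with x the indeterminate and lam a constant polynomial). *)
Definition gen_ffact (A : comNzRingType) (lam x : A) (n : nat) : A :=
  \prod_(i < n) (x - lam *+ i).

Definition poly_ffact (R : comNzRingType) (n : nat) : {poly R} :=
  \prod_(i < n) ('X - i%:R%:P).

Definition is_dstirling2_row (R : comNzRingType) (lam : R) (n : nat)
    (S : {ffun 'I_n.+1 -> R}) : bool :=
  gen_ffact lam%:P 'X n == \sum_(k < n.+1) S k *: poly_ffact R k.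

Lemma dstirling2_row_exists (R : comNzRingType) (lam : R) (n : nat) :
  exists S : {ffun 'I_n.+1 -> R}, is_dstirling2_row lam S.
Proof.
suff [f Ef] : exists f : nat -> R,
    gen_ffact lam%:P 'X n = \sum_(k < n.+1) f k *: poly_ffact R k.
  exists [ffun k : 'I_n.+1 => f k]; rewrite /is_dstirling2_row Ef.
  by apply/eqP/eq_bigr => k _; rewrite ffunE.
elim: n => [|n [f Ef]].
  exists (fun _ => 1).
  by rewrite big_ord1 scale1r /gen_ffact /poly_ffact !big_ord0.
have XE k : 'X * poly_ffact R k = poly_ffact R k.+1 + k%:R *: poly_ffact R k.
  by rewrite /poly_ffact big_ord_recr /= mulrBr -mul_polyC [_ * 'X]mulrC
     [X in _ - X]mulrC subrK.
pose g k := (if k is j.+1 then f j else 0)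
  + (if (k <= n)%N then f k * (k%:R - lam *+ n) else 0).
exists g; rewrite {1}/gen_ffact big_ord_recr /= -/(gen_ffact _ _ n) Ef.
under [RHS]eq_bigr => k _ do rewrite scalerDl.
rewrite big_split /= [X in _ = X + _]big_ord_recl /= scale0r add0r.
rewrite [X in _ = _ + X]big_ord_recr /= ltnn scale0r addr0 -big_split /=.
rewrite mulr_suml; apply: eq_bigr => k _.
rewrite -ltnS ltn_ord -polyCMn -scalerAl mulrBr mulrC XE [_ * _%:P]mulrC.
rewrite mul_polyC -scalerA -scalerDr scalerBl; congr (_ *: _).
by rewrite addrA.
Qed.

Lemma size_poly_ffact (R : comNzRingType) (n : nat) :
  size (poly_ffact R n) = n.+1.
Proof. by rewrite /poly_ffact size_prod_XsubC -[index_enum _]enumT size_enum_ord. Qed.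

Lemma poly_ffact_monic (R : comNzRingType) (n : nat) :
  poly_ffact R n \is monic.
Proof. exact: monic_prod_XsubC. Qed.

Lemma dstirling2_row_unique (R : comNzRingType) (lam : R) (n : nat)
    (S T : {ffun 'I_n.+1 -> R}) :
  is_dstirling2_row lam S -> is_dstirling2_row lam T -> S = T.
Proof.
rewrite /is_dstirling2_row => /eqP ->; rewrite -subr_eq0 -sumrB => /eqP.
under eq_bigr => k _ do rewrite -scalerBl.
move=> E.
suff H m (f : nat -> R) : \sum_(k < m) f k *: poly_ffact R k = 0 ->
    forall k, (k < m)%N -> f k = 0.
  apply/ffunP => k; apply/eqP; rewrite -subr_eq0; apply/eqP.
  have := H n.+1 (fun j => S (inord j) - T (inord j)) _ k (ltn_ord k).
  rewrite inord_val; apply; rewrite -[RHS]E.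
  by apply: eq_bigr => j _; rewrite inord_val.
elim: m => [//|m IH]; rewrite big_ord_recr /= => E0.
have fm : f m = 0.
  have /(congr1 (fun p : {poly R} => p`_m)) := E0.
  rewrite coefD coefZ coef0 coef_sum big1 => [|i _]; last first.
    by rewrite coefZ [X in _ * X]nth_default ?mulr0 // size_poly_ffact ltn_ord.
  have := monicP (poly_ffact_monic R m).
  by rewrite lead_coefE size_poly_ffact /= => ->; rewrite mulr1 add0r.
move=> k; rewrite ltnS leq_eqVlt => /predU1P[-> //|].
by apply: IH; rewrite fm scale0r addr0 in E0.
Qed.

(* The degenerate Stirling numbers {n, k}_lam, 0 <= k <= n: the unique
   coefficients of (x)_{n, lam} on the falling factorials (x)_0, ..., (x)_n. *)
Definition dstirling2 (R : comNzRingType) (lam : R) (n : nat) :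
  {ffun 'I_n.+1 -> R} := xchoose (dstirling2_row_exists lam n).

Lemma dstirling2P (R : comNzRingType) (lam : R) (n : nat) :
  gen_ffact lam%:P 'X n = \sum_(k < n.+1) dstirling2 lam n k *: poly_ffact R k.
Proof. exact/eqP/(xchooseP (dstirling2_row_exists lam n)). Qed.

Definition dbell (R : comNzRingType) (lam : R) (n : nat) : {poly R} :=
  \sum_(k < n.+1) dstirling2 lam n k *: 'X^k.

(* Main.v *)
Require Import Defs.
From HB Require Import structures.
From mathcomp Require Import all_boot all_order all_algebra.
From mathcomp Require Import reals.
Import GRing.Theory.
Local Open Scope ring_scope.

(** Umbral argument.  Let [E] be the linear endomorphism of the polynomials
that sends ['X^k] to the falling factorial $(x)_k$.  It is injective, since it
preserves degrees, and by definition of the degenerate Stirling numbers it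
sends the [n]-th degenerate Bell polynomial to $(x)_{n,\lambda}$
([ffact_lin_dbell]).  Since $(x)_{k+1} = x (x-1)_k$, multiplication by the
indeterminate before applying [E] becomes the operator $p(x) \mapsto x p(x-1)$
after applying it ([ffact_linXM]).

Under [E], the two identities become
$$(x)_{n+1,\lambda} = x \sum_k \binom nk (1-\lambda)_{n-k,\lambda} (x-1)_{k,\lambda},
\qquad
x (x-1)_{n,\lambda} = \sum_k \binom nk (\lambda-1)_{n-k,\lambda} (x)_{k+1,\lambda}.$$
Since $(x)_{m+1,\lambda} = x (x-\lambda)_{m,\lambda}$, both follow from the
Vandermonde formula for generalized falling factorials ([gen_ffactD]), applied
to $x-\lambda = (1-\lambda) + (x-1)$ and $x-1 = (\lambda-1) + (x-\lambda)$. *)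

Section GenFfact.
Context {A : comNzRingType}.
Implicit Types lam x y : A.

Lemma gen_ffact0 lam x : gen_ffact lam x 0 = 1.
Proof. exact: big_ord0. Qed.

Lemma gen_ffactSr lam x n :
  gen_ffact lam x n.+1 = gen_ffact lam x n * (x - lam *+ n).
Proof. exact: big_ord_recr. Qed.

Lemma gen_ffactS lam x n :
  gen_ffact lam x n.+1 = x * gen_ffact lam (x - lam) n.
Proof.
rewrite /gen_ffact big_ord_recl mulr0n subr0; congr (_ * _).
by apply: eq_bigr => i _; rewrite lift0 mulrS opprD addrA.
Qed.

Lemma rmorph_gen_ffact (B : comNzRingType) (f : {rmorphism A -> B}) lam x n :
  f (gen_ffact lam x n) = gen_ffact (f lam) (f x) n.
Proof.
by rewrite rmorph_prod; apply: eq_bigr => i _; rewrite rmorphB rmorphMn.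
Qed.

(** Vandermonde formula for generalized falling factorials. *)
Lemma gen_ffactD lam x y n :
  gen_ffact lam (x + y) n =
  \sum_(k < n.+1) (gen_ffact lam x (n - k) * gen_ffact lam y k) *+ 'C(n, k).
Proof.
elim: n => [|n IH]; first by rewrite big_ord1 !gen_ffact0 mulr1.
rewrite gen_ffactSr IH mulr_suml.
(* Each term is multiplied by (x - (n - k) lam) + (y - k lam). *)
have step (k : 'I_n.+1) :
    (gen_ffact lam x (n - k) * gen_ffact lam y k) *+ 'C(n, k)
      * (x + y - lam *+ n) =
    (gen_ffact lam x (n.+1 - k) * gen_ffact lam y k) *+ 'C(n, k) +
    (gen_ffact lam x (n - k) * gen_ffact lam y k.+1) *+ 'C(n, k).
  have kn : (k <= n)%N by rewrite -ltnS.
  have -> : lam *+ n = lam *+ (n - k) + lam *+ k by rewrite -mulrnDr subnK.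
  rewrite -mulrnDl mulrnAl subSn // !gen_ffactSr.
  by rewrite opprD addrACA mulrDr mulrA mulrAC.
under eq_bigr do rewrite step.
rewrite big_split /= [RHS]big_ord_recl.
under [X in _ = _ + X]eq_bigr do rewrite lift0 binS mulrnDr subSS.
rewrite big_split addrA; congr (_ + _).
rewrite [RHS]addrC [in LHS]big_ord_recl addrC !bin0.
by rewrite [in RHS]big_ord_recr /= bin_small // mulr0n addr0.
Qed.

End GenFfact.

Section FfactLin.
Context {R : comNzRingType}.
Implicit Types p q : {poly R}.

(** The linear map that sends ['X^k] to the falling factorial $(x)_k$. *)
Definition ffact_lin p : {poly R} := \sum_(i < size p) p`_i *: poly_ffact R i.

Lemma ffact_linE m p : (size p <= m)%N ->
  ffact_lin p = \sum_(i < m) p`_i *: poly_ffact R i.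
Proof.
move=> pm; rewrite /ffact_lin (big_ord_widen m (fun i => p`_i *: poly_ffact R i) pm).
rewrite big_mkcond; apply: eq_bigr => i _; case: ltnP => // pi.
by rewrite nth_default // scale0r.
Qed.

Fact ffact_lin_is_linear : linear ffact_lin.
Proof.
move=> a p q; set m := maxn (size p) (size q).
have pm : (size p <= m)%N by exact: leq_maxl.
have qm : (size q <= m)%N by exact: leq_maxr.
rewrite (ffact_linE _ _ pm) (ffact_linE _ _ qm) (ffact_linE m); last first.
  by rewrite (leq_trans (size_polyD _ _)) // geq_max qm
    (leq_trans (size_scale_leq _ _)).
rewrite scaler_sumr -big_split; apply: eq_bigr => i _ /=.
by rewrite coefD coefZ scalerDl scalerA.
Qed.

HB.instance Definition _ :=
  GRing.isLinear.Build R {poly R} {poly R} _ ffact_lin ffact_lin_is_linear.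

Lemma ffact_linXn n : ffact_lin 'X^n = poly_ffact R n.
Proof.
rewrite (ffact_linE n.+1) ?size_polyXn // big_ord_recr /= big1 => [|i _].
  by rewrite coefXn eqxx scale1r add0r.
by rewrite coefXn ltn_eqF // scale0r.
Qed.

(** Falling factorials are monic of distinct degrees, so [ffact_lin] preserves
the leading coefficient. *)
Lemma ffact_lin_inj : injective ffact_lin.
Proof.
have ker0 p : ffact_lin p = 0 -> p = 0.
  rewrite /ffact_lin; case Ep: (size p) => [|m].
    by move=> _; apply/eqP; rewrite -size_poly_eq0 Ep.
  move/(congr1 (fun s : {poly R} => s`_m)).
  rewrite big_ord_recr /= coefD coefZ coef0 coef_sum big1 => [|i _].
    have := monicP (poly_ffact_monic R m).
    rewrite lead_coefE size_poly_ffact /= => ->; rewrite mulr1 add0r => pm0.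
    by apply/eqP; rewrite -lead_coef_eq0 lead_coefE Ep pm0.
  by rewrite coefZ [X in _ * X]nth_default ?mulr0 // size_poly_ffact ltn_ord.
move=> p q Epq; apply/subr0_eq/ker0.
by rewrite linearB /= Epq subrr.
Qed.

Lemma poly_ffactS n :
  poly_ffact R n.+1 = 'X * (poly_ffact R n \Po ('X - 1)).
Proof.
rewrite /poly_ffact big_ord_recl subr0; congr (_ * _).
rewrite rmorph_prod; apply: eq_bigr => i _ /=.
by rewrite comp_polyB comp_polyX comp_polyC -[bump 0 i]/(i.+1) -natr1 polyCD opprD
  addrAC addrA.
Qed.

Lemma ffact_linXM p : ffact_lin ('X * p) = 'X * (ffact_lin p \Po ('X - 1)).
Proof.
rewrite -[p in LHS]coefK poly_def mulr_sumr linear_sum.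
rewrite [ffact_lin p]/ffact_lin linear_sum mulr_sumr; apply: eq_bigr => i _ /=.
by rewrite -scalerAr -exprS linearZ /= ffact_linXn comp_polyZ -scalerAr
  poly_ffactS.
Qed.

Lemma ffact_lin_dbell (lam : R) n :
  ffact_lin (dbell lam n) = gen_ffact lam%:P 'X n.
Proof.
rewrite dstirling2P linear_sum; apply: eq_bigr => k _.
by rewrite linearZ /= ffact_linXn.
Qed.

Lemma ffact_linX_dbell (lam : R) n :
  ffact_lin ('X * dbell lam n) = 'X * gen_ffact lam%:P ('X - 1) n.
Proof.
rewrite ffact_linXM ffact_lin_dbell.
by rewrite rmorph_gen_ffact /= comp_polyC comp_polyX.
Qed.

Lemma gen_ffactD_polyC (lam c : R) p n :
  gen_ffact lam%:P (c%:P + p) n =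
  \sum_(k < n.+1)
    ('C(n, k)%:R * gen_ffact lam c (n - k)) *: gen_ffact lam%:P p k.
Proof.
rewrite gen_ffactD; apply: eq_bigr => k _.
by rewrite -rmorph_gen_ffact mul_polyC mulr_natl scalerMnl.
Qed.

End FfactLin.

Theorem theorem2p7 (R : realType) (lam : R) (hlam : lam != 0) (n : nat) :
  dbell lam n.+1 =
    'X * \sum_(k < n.+1)
           ('C(n, k)%:R * gen_ffact lam (1 - lam) (n - k)%N) *: dbell lam k
  /\
  'X * dbell lam n =
    \sum_(k < n.+1)
      ('C(n, k)%:R * gen_ffact lam (lam - 1) (n - k)%N) *: dbell lam k.+1.
Proof.
split; apply: ffact_lin_inj.
- rewrite ffact_lin_dbell gen_ffactS.
  have -> : 'X - lam%:P = (1 - lam)%:P + ('X - 1) :> {poly R}.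
    by rewrite polyCB [RHS]addrC addrA subrK.
  rewrite gen_ffactD_polyC !mulr_sumr linear_sum; apply: eq_bigr => k _ /=.
  by rewrite -!scalerAr linearZ /= ffact_linX_dbell.
- rewrite ffact_linX_dbell.
  have -> : 'X - 1 = (lam - 1)%:P + ('X - lam%:P) :> {poly R}.
    by rewrite polyCB [RHS]addrC addrA subrK.
  rewrite gen_ffactD_polyC mulr_sumr linear_sum; apply: eq_bigr => k _ /=.
  by rewrite -scalerAr linearZ /= ffact_lin_dbell gen_ffactS.
Qed.
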